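(* Let $\mathcal{F}$ be a non-Archimedean local field and fix $\alpha\in\mathcal{F}$ with $\alpha\neq 0$. (a) If $\operatorname{char}\mathcal{F}=0$, then for Haar-almost every $x\in\mathcal{F}$ with $|x|_\mathfrak{p}>1$, the sequence $([\alpha x^n])_{n\ge 1}$ is uniformly distributed in $\mathcal{O}$. (b) If $\operatorname{char}\mathcal{F}=p>0$, then for Haar-almost every $x\in\mathcal{F}$ with $|x|_\mathfrak{p}>1$, the subsequence $([\alpha x^n])_{n\ge 1,\ p\nmid n}$ (indexed by the positive integers $n$ not divisible by $p$, in increasing order) is uniformly distributed in $\mathcal{O}$.
   Context: $\mathcal{F}$ is a non-Archimedean local field (complete w.r.t. a discrete valuation, finite residue field), with normalized valuation $v_\mathfrak{p}$, valuation ring $\mathcal{O}=\{|x|_\mathfrak{p}\le 1\}$, maximal ideal $\mathfrak{p}$, $q=\#\mathcal{O}/\mathfrak{p}$, absolute value $|x|_\mathfrak{p}=q^{-v_\mathfrak{p}(x)}$, and a fixed prime element $\pi$ ($v_\mathfrak{p}(\pi)=1$). Fix a complete set $C\subset\mathcal{O}$ of representatives of $\mathcal{O}/\mathfrak{p}$ with $0\in C$; every $x\in\mathcal{F}$ is uniquely $x=\sum_{n\ge v}c_n\pi^n$ with $c_n\in C$. The integral part is $[x]=\sum_{n\ge 0}c_n\pi^n\in\mathcal{O}$. For $a\in\mathcal{F}$, $k\in\mathbb{Z}$, $D(a,q^k)=\{x:|x-a|_\mathfrak{p}\le q^k\}$. Haar measure $\mu$ on $\mathcal{F}$ is normalized by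 $\mu(\mathcal{O})=1$. A sequence $(x_n)\subset\mathcal{O}$ is uniformly distributed in $\mathcal{O}$ if for every $a\in\mathcal{O}$ and $k\in\mathbb{N}$, $\lim_{N\to\infty}\frac1N\#\{1\le n\le N: x_n\in D(a,q^{-k})\}=q^{-k}$. *)

(* Defs.v *)
(* Abstract non-Archimedean local field, given by a field F
   together with a normalized discrete valuation v, a prime element pi and a
   complete set C of representatives of O/p containing 0; completeness of F
   is an axiom. *)
From Stdlib Require Import ClassicalEpsilon.
From mathcomp Require Import all_boot all_order all_algebra.
Set Implicit Arguments. Unset Strict Implicit. Unset Printing Implicit Defensive.
Import Order.TTheory GRing.Theory Num.Theory.
Local Open Scope ring_scope.

Section LocalField.
Variables (F : fieldType) (v : F -> int) (pi : F) (C : seq F).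

(* x lies in the closed disc D(a, q^{-k}) = {x : |x - a| <= q^{-k}}
   = {x : x = a or v(x - a) >= k}; the value v 0 is irrelevant. *)
Definition inD (a : F) (k : int) (x : F) : bool := (x == a) || (k <= v (x - a)).

Definition inO (x : F) : bool := inD 0 0 x.

Definition qres : nat := size C.

Definition is_local_field : Prop :=
  (forall x y, x != 0 -> y != 0 -> v (x * y) = v x + v y) /\
  (forall x y, x != 0 -> y != 0 -> x + y != 0 -> Num.min (v x) (v y) <= v (x + y)) /\
  pi != 0 /\ v pi = 1 /\
  0 \in C /\ uniq C /\ (forall c, c \in C -> inO c) /\
  (forall c c', c \in C -> c' \in C -> c != c' -> ~~ inD c' 1 c) /\
  (forall x, inO x -> exists2 c, c \in C & inD c 1 x) /\
  (forall u : nat -> F,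
     (forall k : int, exists N, forall m n, (N <= m)%N -> (N <= n)%N -> inD (u n) k (u m)) ->
     exists l, forall k : int, exists N, forall n, (N <= n)%N -> inD l k (u n)).

Definition is_intpart (x y : F) : Prop :=
  inO y /\ exists s : seq F, all (fun c => c \in C) s /\
    x - y = \sum_(i < size s) s`_i * pi ^- i.+1.

Definition intpart (x : F) : F := epsilon (inhabits 0) (is_intpart x).

Definition abs_gt1 (x : F) : Prop := x != 0 /\ v x < 0.

(* Haar-null set: for every eps = 1/(m+1) it is covered by countably many
   discs D(a_i, q^{-k_i}) (of Haar measure q^{-k_i}) of total measure <= eps *)
Definition haar_null (S : F -> Prop) : Prop :=
  forall m : nat, exists (a : nat -> F) (k : nat -> int),
    (forall x, S x -> exists i, inD (a i) (k i) x) /\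
    (forall N : nat, \sum_(i < N) ((qres%:Q) ^ (- k i)) <= (m.+1%:Q)^-1).

Definition unif_distr (u : nat -> F) : Prop :=
  forall a, inO a -> forall k : nat, forall eps : rat, 0 < eps ->
    exists N0 : nat, forall N : nat, (N0 <= N)%N -> (0 < N)%N ->
      `| (count (fun n => inD a k%:Z (u n)) (iota 1 N))%:Q / N%:Q
         - ((qres%:Q) ^+ k)^-1 | < eps.
End LocalField.

(* enumeration of the positive integers not divisible by p (p >= 2):
   ndiv_enum p 1 = 1 is the first one, ndiv_enum p (j+1) the next after
   ndiv_enum p j (ndiv_enum p 0 = 0 is a dummy starting point). *)
Definition next_ndiv (p m : nat) : nat := if (p %| m.+1)%N then m.+2 else m.+1.
Fixpoint ndiv_enum (p j : nat) : nat :=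
  match j with 0 => 0%N | j'.+1 => next_ndiv p (ndiv_enum p j') end.

(* Main.v *)
From Stdlib Require Import ClassicalEpsilon.
Require Import Defs.
From mathcomp Require Import all_boot all_order all_algebra.
From mathcomp Require Import zify ring lra.
Set Implicit Arguments. Unset Strict Implicit. Unset Printing Implicit Defensive.
Import Order.TTheory GRing.Theory Num.Theory.
Local Open Scope ring_scope.

(* Let |x| = q^m > 1. On a disc of level L_n = m (n - 1) - v(alpha) - v(n) the
   linear term dominates the Taylor expansion, so x |-> alpha x^n is, up to
   scaling, an isometry onto a coset of O; hence exactly one of its q^k subdiscs
   of level L_n + k is sent by the integral part into a given a + p^k. Along a
   progression n = n_0 + M i with M >= k on which v(n) is constant, the levels
   satisfy L_{n+M} >= L_n + k, so these events are exactly independent with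
   probability q^-k; a fourth moment bound and a Borel-Cantelli cover give the
   strong law. The residue classes mod M with v(n) constant make up all but an
   arbitrarily small proportion of the exponents: in characteristic 0 take M
   divisible by a high power of the residue characteristic, in characteristic p
   take M divisible by p and n prime to p. *)

(** * Valuations and residue systems *)

Section Valuation.
Variables (F : fieldType) (v : F -> int) (pi : F) (C : seq F).
Hypothesis HF : is_local_field v pi C.

Definition val_ge (k : int) (x : F) : bool := (x == 0) || (k <= v x).

Lemma inDE a k x : inD v a k x = val_ge k (x - a).
Proof. by rewrite /inD /val_ge subr_eq0. Qed.

Lemma inOE x : inO v x = val_ge 0 x.
Proof. by rewrite /inO inDE subr0. Qed.

Lemma valM x y : x != 0 -> y != 0 -> v (x * y) = v x + v y.
Proof. by case: HF => H _; apply: H. Qed.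

Lemma val_min x y : x != 0 -> y != 0 -> x + y != 0 ->
  Num.min (v x) (v y) <= v (x + y).
Proof. by case: HF => _ [H _]; apply: H. Qed.

Lemma pi_neq0 : pi != 0.
Proof. by case: HF => _ [_ [H _]]. Qed.

Lemma val_pi : v pi = 1.
Proof. by case: HF => _ [_ [_ [H _]]]. Qed.

Lemma val1 : v 1 = 0.
Proof. by have := @valM 1 1 (oner_neq0 F) (oner_neq0 F); rewrite mulr1; lia. Qed.

Lemma valN x : v (- x) = v x.
Proof.
have N1 : (-1 : F) != 0 by rewrite oppr_eq0 oner_neq0.
have vN1 : v (-1) = 0.
  by have := @valM (-1) (-1) N1 N1; rewrite mulrNN mulr1 val1; lia.
have [->|x0] := eqVneq x 0; first by rewrite oppr0.
by rewrite -mulN1r valM // vN1 add0r.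
Qed.

Lemma val_ge_0 k : val_ge k 0.
Proof. by rewrite /val_ge eqxx. Qed.

Lemma val_geE k x : x != 0 -> val_ge k x = (k <= v x).
Proof. by rewrite /val_ge => /negPf ->. Qed.

Lemma val_ge_val x : val_ge (v x) x.
Proof. by rewrite /val_ge lexx orbT. Qed.

Lemma val_ge_le l k x : l <= k -> val_ge k x -> val_ge l x.
Proof.
by rewrite /val_ge => lk /orP[->//|kx]; rewrite (le_trans lk kx) orbT.
Qed.

Lemma val_geN k x : val_ge k (- x) = val_ge k x.
Proof. by rewrite /val_ge oppr_eq0 valN. Qed.

Lemma val_geD k x y : val_ge k x -> val_ge k y -> val_ge k (x + y).
Proof.
have [->|x0] := eqVneq x 0; first by rewrite add0r.
have [->|y0] := eqVneq y 0; first by rewrite addr0.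
have [->|xy0] := eqVneq (x + y) 0; first by rewrite val_ge_0.
rewrite !val_geE // => kx ky; apply: le_trans (val_min x0 y0 xy0).
by rewrite le_min kx.
Qed.

Lemma val_geB k x y : val_ge k x -> val_ge k y -> val_ge k (x - y).
Proof. by move=> kx ky; apply: val_geD => //; rewrite val_geN. Qed.

Lemma val_geM k l x y : val_ge k x -> val_ge l y -> val_ge (k + l) (x * y).
Proof.
have [->|x0] := eqVneq x 0; first by rewrite mul0r !val_ge_0.
have [->|y0] := eqVneq y 0; first by rewrite mulr0 !val_ge_0.
by rewrite !val_geE ?mulf_neq0 // valM //; lia.
Qed.

Lemma val_geDl k x y : val_ge k y -> val_ge k (x + y) = val_ge k x.
Proof.
move=> ky; apply/idP/idP => h; last exact: val_geD.
by rewrite -[x](addrK y); apply: val_geB.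
Qed.

(** The term of strictly smaller valuation governs a sum: otherwise [x = (x + y) - y] would have
    valuation above [v x]. *)
Lemma val_add_gt x y : x != 0 -> val_ge (v x + 1) y ->
  (x + y != 0) /\ (v (x + y) = v x).
Proof.
move=> x0 ky.
have nx : ~~ val_ge (v x + 1) (x + y) by rewrite val_geDl // val_geE //; lia.
have xy0 : x + y != 0 by apply: contraNneq nx => ->; rewrite val_ge_0.
split=> //; rewrite val_geE // in nx.
have : val_ge (v x) (x + y).
  by apply: val_geD; [exact: val_ge_val | apply: val_ge_le ky; lia].
by rewrite val_geE //; lia.
Qed.

Lemma val_ge_scale k z x : z != 0 -> val_ge (v z + k) (z * x) = val_ge k x.
Proof.
move=> z0; have [->|x0] := eqVneq x 0; first by rewrite mulr0 !val_ge_0.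
by rewrite !val_geE ?mulf_neq0 // valM //; lia.
Qed.

Lemma val_geX n k x : val_ge k x -> val_ge (k *+ n) (x ^+ n).
Proof.
move=> kx; elim: n => [|n IH]; first by rewrite expr0 val_geE ?oner_neq0 // val1.
by rewrite exprS mulrS; apply: val_geM.
Qed.

Lemma valX n x : x != 0 -> v (x ^+ n) = v x *+ n.
Proof.
move=> x0; elim: n => [|n IH]; first by rewrite expr0 val1.
by rewrite exprS mulrS valM ?expf_neq0 // IH.
Qed.

Lemma val_ge_nat n : val_ge 0 n%:R.
Proof.
elim: n => [|n IH]; first exact: val_ge_0.
by rewrite -natr1; apply: val_geD => //; rewrite val_geE ?oner_neq0 // val1.
Qed.

Lemma valV x : x != 0 -> v x^-1 = - v x.
Proof.
by move=> x0; have := valM x0 (invr_neq0 x0); rewrite divff // val1; lia.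
Qed.

Lemma expfz_pi_neq0 (l : int) : pi ^ l != 0.
Proof. exact: expfz_neq0 pi_neq0. Qed.

Lemma val_expz_pi (l : int) : v (pi ^ l) = l.
Proof.
case: l => n /=; first by rewrite -exprnP valX ?pi_neq0 // val_pi; lia.
by rewrite valV ?expf_neq0 ?pi_neq0 // valX ?pi_neq0 // val_pi; lia.
Qed.

Lemma val_ge_uniformizer k x : val_ge (k + 1) (pi * x) = val_ge k x.
Proof. by rewrite addrC -val_pi val_ge_scale // pi_neq0. Qed.

Lemma val_ge1_uniformizer x : val_ge 1 (pi * x) = val_ge 0 x.
Proof. by rewrite -(val_ge_uniformizer 0) add0r. Qed.

Lemma digit_ge0 c : c \in C -> val_ge 0 c.
Proof.
case: HF => _ [_ [_ [_ [_ [_ [H _]]]]]] cC.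
by rewrite -inOE; apply: H.
Qed.

Lemma digit_inj c d : c \in C -> d \in C -> val_ge 1 (c - d) -> c = d.
Proof.
case: HF => _ [_ [_ [_ [_ [_ [_ [H _]]]]]]] cC dC; rewrite -inDE => h.
by apply/eqP; apply: contraTT h => /(H _ _ cC dC).
Qed.

Lemma digit_exists x : val_ge 0 x -> exists2 c, c \in C & val_ge 1 (x - c).
Proof.
case: HF => _ [_ [_ [_ [_ [_ [_ [_ [H _]]]]]]]]; rewrite -inOE => /H[c cC].
by rewrite inDE; exists c.
Qed.

Lemma digit0 : 0 \in C. Proof. by case: HF => _ [_ [_ [_ [H _]]]]. Qed.

Lemma digit_uniq : uniq C. Proof. by case: HF => _ [_ [_ [_ [_ [H _]]]]]. Qed.

Lemma qres_gt1 : (1 < qres C)%N.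
Proof.
have [|c cC c1] := @digit_exists 1; first by rewrite val_geE ?oner_neq0 // val1.
have c0 : c != 0.
  by apply: contraTneq c1 => ->; rewrite subr0 val_geE ?oner_neq0 // val1.
have: uniq [:: c; 0] by rewrite /= inE c0.
move/uniq_leq_size; apply => y; rewrite !inE => /orP[]/eqP -> //; exact: digit0.
Qed.

(** Truncated digit expansions [c_0 + c_1 pi + ... + c_(k-1) pi^(k-1)] in Horner form; they
    represent the classes of O modulo p^k. *)
Fixpoint residues (k : nat) : seq F :=
  if k is k'.+1 then [seq c + pi * e | c <- C, e <- residues k'] else [:: 0].

Lemma residues_ge0 k e : e \in residues k -> val_ge 0 e.
Proof.
elim: k e => [|k IH] e /=; first by rewrite inE => /eqP ->; exact: val_ge_0.
move=> /allpairsP[[c d] /= [cC dk ->]]; apply: val_geD; first exact: digit_ge0.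
by apply: (@val_ge_le _ 1) => //; rewrite val_ge1_uniformizer IH.
Qed.

Lemma residues_exists k x : val_ge 0 x ->
  exists2 e, e \in residues k & val_ge k%:Z (x - e).
Proof.
elim: k x => [|k IH] x x0 /=; first by exists 0; rewrite ?inE ?subr0.
have [c cC xc] := digit_exists x0.
have pE : x - c = pi * (pi^-1 * (x - c)) by rewrite mulVKf // pi_neq0.
move: (xc); rewrite {1}pE val_ge1_uniformizer => /IH[e ek xe].
exists (c + pi * e); first by apply/allpairsP; exists (c, e).
by rewrite opprD addrA pE -mulrBr -addn1 PoszD val_ge_uniformizer.
Qed.

Lemma digit_residue_inj k c d e f : c \in C -> d \in C ->
  e \in residues k -> f \in residues k ->
  val_ge (k.+1)%:Z ((c + pi * e) - (d + pi * f)) ->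
  (c = d) /\ (val_ge k%:Z (e - f)).
Proof.
move=> cC dC ek fk; have -> : (c + pi * e) - (d + pi * f) = (c - d) + pi * (e - f) by ring.
move=> h; have cd : c = d.
  apply: digit_inj => //; rewrite -(@val_geDl 1 _ (pi * (e - f))).
    by apply: val_ge_le h; lia.
  by rewrite val_ge1_uniformizer; apply: val_geB; apply: residues_ge0; eassumption.
by split=> //; move: h; rewrite cd subrr add0r -addn1 PoszD val_ge_uniformizer.
Qed.

Lemma residues_inj k e f : e \in residues k -> f \in residues k ->
  val_ge k%:Z (e - f) -> e = f.
Proof.
elim: k e f => [|k IH] e f /=; first by rewrite !inE => /eqP -> /eqP ->.
move=> /allpairsP[[c e'] /= [cC ek ->]] /allpairsP[[d f'] /= [dC fk ->]].
by move/digit_residue_inj => [] // -> /IH ->.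
Qed.

Lemma residues_uniq k : uniq (residues k).
Proof.
elim: k => [//|k IH]; apply: allpairs_uniq => //; first exact: digit_uniq.
move=> [c e] [d f] /allpairsP[[? ?] /= [cC ek [-> ->]]].
move=> /allpairsP[[? ?] /= [dC fk [-> ->]]] /= E.
have := digit_residue_inj cC dC ek fk.
rewrite E subrr val_ge_0 => /(_ isT)[-> ef].
by rewrite (residues_inj ek fk ef).
Qed.

Lemma size_residues k : size (residues k) = (qres C ^ k)%N.
Proof. by elim: k => [//|k IH]; rewrite /= size_allpairs IH expnS. Qed.

End Valuation.

(** * Integral parts and the expansion of powers *)

Section IntegralPart.
Variables (F : fieldType) (v : F -> int) (pi : F) (C : seq F).
Hypothesis HF : is_local_field v pi C.
Local Notation val_ge := (val_ge v).

(** Horner form of the polar part [sum c_i pi^-(i+1)], suited to induction on the digit list. *)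
Fixpoint polar (s : seq F) : F := if s is c :: s' then pi^-1 * (c + polar s') else 0.

Lemma polarE s : \sum_(i < size s) s`_i * pi ^- i.+1 = polar s.
Proof.
elim: s => [|c s IH]; first by rewrite big_ord0.
rewrite big_ord_recl /= -IH mulrDr expr1 mulr_sumr mulrC; congr (_ + _).
by apply: eq_bigr => i _; rewrite /= /bump /= add1n [in LHS]exprS invfM; ring.
Qed.

(** Multiplying the difference by [pi] puts [(c - c') + (x - x')] in the maximal ideal. As digits
    are integral, so is [x - x']; by induction it vanishes, and then [c = c']. *)
Lemma polar_unique s s' : all (fun c => c \in C) s -> all (fun c => c \in C) s' ->
  val_ge 0 (polar s - polar s') -> polar s = polar s'.
Proof.
have step c c' x x' : c \in C -> c' \in C -> (val_ge 0 (x - x') -> x = x') ->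
    val_ge 0 (pi^-1 * (c + x) - pi^-1 * (c' + x')) ->
    pi^-1 * (c + x) = pi^-1 * (c' + x').
  move=> cC cC' xx'; rewrite -mulrBr -(val_ge1_uniformizer HF).
  rewrite mulVKf ?(pi_neq0 HF) // opprD addrACA => h.
  have ex : x = x'.
    apply: xx'; rewrite -(@val_geDl _ _ _ _ HF 0 (x - x') (c - c')).
      by rewrite addrC; apply: val_ge_le h.
    by apply: (val_geB HF); apply: (digit_ge0 HF).
  by move: h; rewrite ex subrr addr0 => /(digit_inj HF cC cC') ->.
(* The empty list is treated as one starting with the digit 0, so lists of unequal length go through
   the same step. *)
have nilE : 0 = pi^-1 * (0 + 0) :> F by rewrite addr0 mulr0.
elim: s s' => [|c s IH] s'.
  elim: s' => [//|c' s' IH'] /= _ /andP[cC' sC']; rewrite nilE.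
  by apply: step => //; [exact: digit0 HF | exact: IH'].
case: s' => [|c' s'] /= /andP[cC sC].
  move=> sC'; rewrite [X in _ - X]nilE [X in _ = X]nilE.
  by apply: step => //; [exact: digit0 HF | exact: (IH [::])].
by case/andP=> cC' sC'; apply: step => //; exact: IH.
Qed.

(** Induction on the order of the pole: if [y] is an integral part of [pi * x], its lowest digit [c]
    becomes the first polar digit of [x], and [(y - c) / pi] is an integral part of [x]. *)
Lemma is_intpart_exists x : exists y, is_intpart v pi C x y.
Proof.
have [n xn] : exists n : nat, val_ge (- n%:Z) x.
  by exists `|v x|%N; apply: val_ge_le (val_ge_val v x); lia.
elim: n x xn => [|n IH] x xn.
  exists x; split; first by rewrite inOE.
  by exists [::]; rewrite subrr big_ord0.
have /IH[y [y0 [s [sC ys]]]] : val_ge (- n%:Z) (pi * x).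
  by rewrite -[- n%:Z](subrK 1) (val_ge_uniformizer HF); apply: val_ge_le xn; lia.
rewrite inOE in y0; have [c cC yc] := digit_exists HF y0.
exists (pi^-1 * (y - c)); split.
  by rewrite inOE -(val_ge1_uniformizer HF) mulVKf ?(pi_neq0 HF).
exists (c :: s); split; first by rewrite /= cC.
rewrite polarE /= -polarE -ys; field; exact: pi_neq0 HF.
Qed.

Lemma intpartP x : is_intpart v pi C x (intpart v pi C x).
Proof. exact: epsilon_spec (is_intpart_exists x). Qed.

Lemma intpart_ge0 x : val_ge 0 (intpart v pi C x).
Proof. by rewrite -inOE; case: (intpartP x). Qed.

(** The polar parts of [x] and [y] differ by an integral element, hence coincide. Together with
    [intpart_ge0] this is all that the later arguments use about integral parts. *)
Lemma intpart_sub x y : val_ge 0 (x - y) ->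
  intpart v pi C x - intpart v pi C y = x - y.
Proof.
move=> xy; have [x0 [s [sC]]] := intpartP x; have [y0 [t [tC]]] := intpartP y.
rewrite !polarE inOE in x0 y0 *; move=> yt xs.
rewrite inOE in x0 y0.
have : polar s = polar t.
  apply: polar_unique => //; rewrite -xs -yt.
  have -> : forall a b c d : F, a - b - (c - d) = (a - c) - (b - d) by move=> *; ring.
  by apply: (val_geB HF) => //; apply: (val_geB HF).
rewrite -xs -yt => /eqP; rewrite -subr_eq0 => /eqP E; apply/eqP.
by rewrite -subr_eq0 -oppr_eq0 -E; apply/eqP; ring.
Qed.

(** The remainder is quadratic in [y - x]: passing from [n] to [n + 1] multiplies it by [y] and adds
    [(n + 1) x^n (y - x)^2]. *)
Lemma taylor_ge m n x y H : val_ge (- m) x -> val_ge (- m) y ->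
  val_ge H (y - x) ->
  val_ge (H *+ 2 - m * (n%:Z - 1)) (y ^+ n.+1 - x ^+ n.+1 - (n.+1)%:R * x ^+ n * (y - x)).
Proof.
move=> xm ym h; elim: n => [|n IH].
  by rewrite !expr1 expr0 !mul1r subrr val_ge_0.
have -> : y ^+ n.+2 - x ^+ n.+2 - (n.+2)%:R * x ^+ n.+1 * (y - x) =
   y * (y ^+ n.+1 - x ^+ n.+1 - (n.+1)%:R * x ^+ n * (y - x)) +
   (n.+1)%:R * x ^+ n * ((y - x) * (y - x)).
  by rewrite -[n.+2%:R]natr1 !(exprS _ n.+1) [x ^+ n.+1]exprS; ring.
apply: (val_geD HF).
  apply: (@val_ge_le _ _ _ (- m + (H *+ 2 - m * (n%:Z - 1)))); first by lia.
  exact: (val_geM HF).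
apply: (@val_ge_le _ _ _ (0 + (- m) *+ n + (H + H))); first by lia.
apply: (val_geM HF); last exact: (val_geM HF).
by apply: (val_geM HF); [exact: val_ge_nat HF _ | apply: (val_geX HF)].
Qed.

Section Isometry.
Variables (alpha : F) (m : int) (n : nat) (w : int).
Hypotheses (alpha0 : alpha != 0) (n0 : (n.+1)%:R != 0 :> F) (nw : v (n.+1)%:R = w).

(** Minus the valuation of the derivative [alpha (n + 1) x^n] when [v x = - m]: the level from which
    the linear term scales discs up to cosets of O. *)
Definition fine_level : int := m * n%:Z - v alpha - w.

Lemma pow_isometry x y : x != 0 -> v x = - m -> val_ge fine_level (y - x) ->
  0 < fine_level + m - w -> y != x ->
  (alpha * y ^+ n.+1 - alpha * x ^+ n.+1 != 0) /\
  (v (alpha * y ^+ n.+1 - alpha * x ^+ n.+1) = v (y - x) - fine_level).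
Proof.

move=> x0 vx h; have w0 : 0 <= w.
  by rewrite -nw; have := val_ge_nat HF n.+1; rewrite val_geE.
move=> Lw; rewrite -subr_eq0 => h0; rewrite -mulrBr.
have Hh : fine_level <= v (y - x) by rewrite -val_geE.
have xm : val_ge (- m) x by rewrite -vx val_ge_val.
have ym : val_ge (- m) y.
  by rewrite -[y](subrK x); apply: (val_geD HF) => //; apply: val_ge_le h; lia.
have R := taylor_ge n xm ym (val_ge_val v (y - x)).
set M := _ * (y - x) in R.
have M0 : M != 0 by rewrite !mulf_neq0 ?expf_neq0.
have vM : v M = w + (- m) *+ n + v (y - x).
  by rewrite !(valM HF) ?mulf_neq0 ?expf_neq0 // (valX HF) // vx nw.
(* The remainder exceeds the linear term [M] in valuation by at least [v (y - x) + m - w], which is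
   positive by [Lw] and [Hh]. *)
have [|] := @val_add_gt _ _ _ _ HF M (y ^+ n.+1 - x ^+ n.+1 - M) M0.
  by apply: val_ge_le R; rewrite vM; lia.
rewrite addrC subrK => D0 vD; rewrite mulf_neq0 // (valM HF) // vD vM /fine_level; split=> //; lia.
Qed.
End Isometry.
End IntegralPart.

(** * Fourth moment and disc covers *)

(* With [s = th * (1 - th)] this is the fourth moment of [t + X_1 + ... + X_N],
   the X_i being independent with values 1 - th and - th and mean 0. *)
Definition moment4 (th : rat) (N : nat) (t : rat) : rat :=
  let s := th * (1 - th) in
  t ^+ 4 + t ^+ 2 * N%:R * s *+ 6 + t * N%:R * s * (1 - th *+ 2) *+ 4
  + N%:R * (th * (1 - th) ^+ 4 + (1 - th) * th ^+ 4)
  + N%:R * (N%:R - 1) * s ^+ 2 *+ 3.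

(** Conditioning on the first of N + 1 independent variables; this recursion drives the induction in
    [excess_tail]. *)
Lemma moment4_step th N t :
  moment4 th N.+1 t =
  th * moment4 th N (t + (1 - th)) + (1 - th) * moment4 th N (t + (0 - th)).
Proof. by rewrite /moment4 -natr1; ring. Qed.

(** The variance and the fourth moment of one variable are at most 1, whence the bound
    [N + 3 N (N - 1)]. *)
Lemma moment4_le th N : 0 <= th -> th <= 1 -> moment4 th N 0 <= N%:R ^+ 2 *+ 4.
Proof.
move=> t0 t1; rewrite /moment4.
have s0 : 0 <= th * (1 - th) by nra.
have s1 : th * (1 - th) <= 1 by nra.
have s2 : (th * (1 - th)) ^+ 2 <= 1 by rewrite exprn_ile1.
have m4 : th * (1 - th) ^+ 4 + (1 - th) * th ^+ 4 <= 1.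
  have : (1 - th) ^+ 4 <= 1 by rewrite exprn_ile1 //; lra.
  have : th ^+ 4 <= 1 by rewrite exprn_ile1 //; lra.
  nra.
case: N => [|N]; first by rewrite mulr0n; lra.
have N1 : 1 <= N.+1%:R :> rat by rewrite ler1n.
move: (N.+1%:R) N1 => n n1.
move: (th * (1 - th) ^+ 4 + _) m4 ((th * (1 - th)) ^+ 2) s2 => y y1 z z1.
have : n * y <= n by rewrite ler_piMr //; lra.
have : n * (n - 1) * z <= n * (n - 1) by rewrite ler_piMr //; nra.
nra.
Qed.

Section Discs.
Variables (F : fieldType) (v : F -> int) (pi : F) (C : seq F).
Hypothesis HF : is_local_field v pi C.
Local Notation val_ge := (val_ge v).
Local Notation q := ((qres C)%:Q).

Definition disc_measure (l : int) : rat := q ^ (- l).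

Lemma qres_gt0 : 0 < q. Proof. have := qres_gt1 HF; rewrite ltr0z; lia. Qed.

Lemma disc_measure_gt0 l : 0 < disc_measure l.
Proof. by rewrite exprz_gt0 // qres_gt0. Qed.

Lemma disc_measureD l (j : nat) :
  disc_measure (l + j%:Z) = disc_measure l / (q ^+ j).
Proof.
rewrite /disc_measure opprD expfzDr ?gt_eqF ?qres_gt0 // exprnN.
by [].
Qed.

(** The constant [c] bounds the conditional probability of [S] given the disc. Finite covers
    suffice, because the events considered depend on finitely many digits. *)
Definition disc_bounded (S : F -> Prop) (b : F) (l : int) (c : rat) : Prop :=
  exists s : seq (F * int),
    (forall x, inD v b l x -> S x -> exists2 d, d \in s & inD v d.1 d.2 x) /\
    \sum_(d <- s) disc_measure d.2 <= c * disc_measure l.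

Lemma disc_bounded_sub (S T : F -> Prop) b l c :
  (forall x, inD v b l x -> S x -> T x) -> disc_bounded T b l c ->
  disc_bounded S b l c.
Proof. by move=> ST [s [Hs sc]]; exists s; split=> // x xb /(ST x xb); exact: Hs. Qed.

Lemma subdisc_exists b l (j : nat) x : inD v b l x ->
  exists2 e, e \in residues pi C j & inD v (b + pi ^ l * e) (l + j%:Z) x.
Proof.
rewrite inDE => xb; have p0 := expfz_pi_neq0 HF l.
have E : x - b = pi ^ l * (pi ^ (- l) * (x - b)).
  by rewrite mulrA -expfzDr ?(pi_neq0 HF) // subrr expr0z mul1r.
have : val_ge 0 (pi ^ (- l) * (x - b)).
  by rewrite -(val_ge_scale HF _ _ p0) -E (val_expz_pi HF) addr0.
case/(residues_exists HF j) => e ej xe; exists e => //.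
rewrite inDE opprD addrA E -mulrBr.
by rewrite -{1}(val_expz_pi HF l) (val_ge_scale HF).
Qed.

(** Law of total probability over the [q^j] subdiscs. *)
Lemma disc_bounded_split S b l (j : nat) (c : F -> rat) :
  (forall e, e \in residues pi C j ->
     disc_bounded S (b + pi ^ l * e) (l + j%:Z) (c e)) ->
  disc_bounded S b l ((\sum_(e <- residues pi C j) c e) / q ^+ j).
Proof.
move=> H.
(* The claim is restated for the subdiscs indexed by a list, so that induction on that list
   applies. *)
suff [s [Hs sc]] : exists s : seq (F * int),
    (forall x, (exists2 e, e \in residues pi C j & inD v (b + pi ^ l * e) (l + j%:Z) x) ->
       S x -> exists2 d, d \in s & inD v d.1 d.2 x) /\
    \sum_(d <- s) disc_measure d.2 <=
      (\sum_(e <- residues pi C j) c e) * disc_measure (l + j%:Z).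
  exists s; split; first by move=> x /(subdisc_exists j); exact: Hs.
  by rewrite mulrAC -mulrA -disc_measureD.
elim: (residues pi C j) H => [|e r IH] H.
  by exists [::]; split; [move=> x [] | rewrite !big_nil mul0r].
have [s1 [Hs1 sc1]] := H e (mem_head _ _).
have [f fr|s2 [Hs2 sc2]] := IH; first by apply: H; rewrite inE fr orbT.
exists (s1 ++ s2); split; last by rewrite big_cat big_cons mulrDl lerD.
move=> x [f]; rewrite inE => /orP[/eqP ->|fr] xf Sx.
  by have [d ds xd] := Hs1 x xf Sx; exists d; rewrite ?mem_cat ?ds.
have [|d ds xd] := Hs2 x _ Sx; first by exists f.
by exists d; rewrite ?mem_cat ?ds ?orbT.
Qed.

(* Surjectivity comes from counting residues, not from completeness of F. *)
Lemma sum_hit_once (k : nat) (f : F -> F) (a : F) (g : bool -> rat) :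
  val_ge 0 a ->
  (forall e, e \in residues pi C k -> val_ge 0 (f e)) ->
  (forall e e', e \in residues pi C k -> e' \in residues pi C k ->
     val_ge k%:Z (f e - f e') -> e = e') ->
  \sum_(e <- residues pi C k) g (inD v a k%:Z (f e)) =
    g true + (q ^+ k - 1) * g false.
Proof.
move=> a0 f0 finj.
pose rep x := nth 0 (residues pi C k)
                (find (fun e => val_ge k%:Z (x - e)) (residues pi C k)).
have repP x : val_ge 0 x -> (rep x \in residues pi C k) /\ val_ge k%:Z (x - rep x).
  move=> /(residues_exists HF k)[e ek xe].
  have h : has (fun e => val_ge k%:Z (x - e)) (residues pi C k) by apply/hasP; exists e.
  by split; [rewrite mem_nth // -has_find | exact: (nth_find 0 h)].
have rep_eq x y : val_ge 0 x -> val_ge 0 y -> (rep x = rep y) -> val_ge k%:Z (x - y).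
  move=> /repP[_ hx] /repP[_ hy] E.
  have -> : x - y = (x - rep x) - (y - rep y) by rewrite E; ring.
  exact: (val_geB HF).
have un := residues_uniq HF k.
have un' : uniq (map (rep \o f) (residues pi C k)).
  rewrite map_inj_in_uniq // => e e' ek ek' /= E; apply: finj => //.
  by apply: rep_eq => //; apply: f0.
have sub : {subset map (rep \o f) (residues pi C k) <= residues pi C k}.
  by move=> _ /mapP[e ek ->]; case: (repP _ (f0 _ ek)).
(* An injection of the finite list of residues into itself is onto; [e0] below is the preimage of
   the residue of [a]. *)
have [_ eqm] := uniq_min_size un' sub (eq_leq (esym (size_map _ _))).
have [ra _] := repP _ a0.
have /mapP[e0 e0k ae] : rep a \in map (rep \o f) (residues pi C k) by rewrite eqm.
have hit e : e \in residues pi C k -> inD v a k%:Z (f e) = (e == e0).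
  move=> ek; rewrite inDE; apply/idP/eqP => [h|->].
    apply: finj => //; have -> : f e - f e0 = (f e - a) + (a - f e0) by ring.
    by apply: (val_geD HF) => //; apply: rep_eq => //; apply: f0.
  by apply: rep_eq => //; apply: f0.
rewrite (bigD1_seq e0) //= hit // eqxx; congr (_ + _).
rewrite big_seq_cond (eq_bigr (fun=> g false)); last first.
  by move=> e /andP[ek /negPf ee]; rewrite hit // ee.
rewrite -big_seq_cond -big_filter big_const_seq count_predT iter_addr addr0.
rewrite -rem_filter // size_rem // size_residues -mulr_natl.
rewrite -subn1 natrB ?natrX ?expn_gt0 ?(ltnW (qres_gt1 HF)) //.
Qed.
End Discs.

(** * Independence along a progression *)

Section Tree.
Variables (F : fieldType) (v : F -> int) (pi : F) (C : seq F).
Hypothesis HF : is_local_field v pi C.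
Local Notation val_ge := (val_ge v).
Local Notation q := ((qres C)%:Q).
Local Notation disc_bounded := (disc_bounded v C).
Local Notation intpart := (intpart v pi C).

Lemma disc_bounded_split_const S b l (j : nat) (c : rat) :
  (forall e, e \in residues pi C j ->
     disc_bounded S (b + pi ^ l * e) (l + j%:Z) c) ->
  disc_bounded S b l c.
Proof.
move=> H; have := disc_bounded_split HF (c := fun=> c) H.
rewrite big_const_seq count_predT iter_addr addr0 size_residues.
rewrite -mulr_natl natrX mulrAC divff ?mul1r //.
by rewrite expf_neq0 // gt_eqF // (qres_gt0 HF).
Qed.

Definition hit (alpha a : F) (k n : nat) (x : F) : bool :=
  inD v a k%:Z (intpart (alpha * x ^+ n)).

Definition excess (alpha a : F) (k n : nat) (x : F) : rat :=
  (hit alpha a k n x)%:R - (q ^+ k)^-1.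

Variables (alpha a : F) (k : nat) (m : int) (n0 M : nat) (w : int).
Hypotheses (alpha0 : alpha != 0) (a0 : val_ge 0 a) (m1 : 1 <= m) (kM : (k <= M)%N).
Hypothesis nval : forall i, ((n0 + M * i).+1%:R != 0 :> F) /\ v (n0 + M * i).+1%:R = w.
Hypothesis n0_large : 0 < fine_level v alpha m n0 w + m - w.

Local Notation th := ((q ^+ k)^-1).
Local Notation lev i := (fine_level v alpha m (n0 + M * i) w).
Local Notation exc i := (excess alpha a k (n0 + M * i).+1).
Local Notation map_at i x := (intpart (alpha * x ^+ (n0 + M * i).+1)).

Lemma lev_large i : 0 < lev i + m - w.
Proof.
have : 0 <= m * (M * i)%:Z by apply: mulr_ge0; lia.
by move: n0_large; rewrite /fine_level PoszD mulrDr; lia.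
Qed.

(** Independence rests on this: [k <= M] makes each level at least [k] deeper than the previous one,
    and the truncated subtraction is exact. *)
Lemma levS i : lev i.+1 = lev i + (k + (absz m * M - k))%N%:Z.
Proof.
have mM : (k <= absz m * M)%N by apply: leq_trans kM _; rewrite leq_pmull //; lia.
have E : (absz m * M)%N%:Z = m * M%:Z by rewrite PoszM; congr (_ * _); lia.
by rewrite subnKC // E /fine_level mulnS !PoszD !mulrDr; ring.
Qed.

Lemma lev_gt i : - m < lev i.
Proof.
have := lev_large i; have [n0' nw] := nval i.
by have := val_ge_nat HF (n0 + M * i).+1; rewrite val_geE // nw; lia.
Qed.

Lemma val_in_disc i b x : b != 0 -> v b = - m -> val_ge (lev i) (x - b) ->
  (x != 0) /\ (v x = - m).
Proof.
move=> b0 vb xb; have [|] := @val_add_gt _ _ _ _ HF b (x - b) b0.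
  by apply: val_ge_le xb; have := lev_gt i; lia.
by rewrite addrC subrK vb.
Qed.

(** Before integral parts are taken, the images differ by an element of valuation
    [v (y - x) - lev i]. This is nonnegative, so [intpart_sub] preserves the difference. *)
Lemma map_at_isometry i x y j : x != 0 -> v x = - m -> val_ge (lev i) (y - x) ->
  0 <= j -> val_ge j (map_at i y - map_at i x) = val_ge (lev i + j) (y - x).
Proof.
move=> x0 vx yx j0; have [->|nyx] := eqVneq y x; first by rewrite !subrr !val_ge_0.
have [nn nw] := nval i.
have [D0 vD] := pow_isometry HF alpha0 nn nw x0 vx yx (lev_large i) nyx.
have yx0 : y - x != 0 by rewrite subr_eq0.
rewrite (val_geE _ _ yx0) in yx; rewrite (intpart_sub HF).
  by rewrite (val_geE _ _ yx0) val_geE // vD; lia.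
by rewrite val_geE // vD; lia.
Qed.

Lemma hit_subdisc i b x : b != 0 -> v b = - m ->
  inD v b (lev i + k%:Z) x -> exc i x = exc i b.
Proof.
move=> b0 vb; rewrite inDE => xb; rewrite /excess /hit !inDE.
have xb' : val_ge (lev i) (x - b) by apply: val_ge_le xb; lia.
have h : val_ge k%:Z (map_at i x - map_at i b) by rewrite map_at_isometry.
suff -> : val_ge k%:Z (map_at i x - a) = val_ge k%:Z (map_at i b - a) by [].
by rewrite -(subrKA (map_at i b)) addrC (@val_geDl _ _ _ _ HF _ _ (map_at i x - map_at i b)).
Qed.

(** Conditional law of [exc i] given a disc of level [lev i]: by [sum_hit_once], exactly one of its
    [q^k] subdiscs is a hit. *)
Lemma sum_subdiscs i b (g : rat -> rat) : b != 0 -> v b = - m ->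
  \sum_(e <- residues pi C k) g (exc i (b + pi ^ (lev i) * e)) / q ^+ k =
  th * g (1 - th) + (1 - th) * g (0 - th).
Proof.
move=> b0 vb; rewrite -mulr_suml.
have p0 := expfz_pi_neq0 HF (lev i).
have close e e' j : val_ge (lev i + j) (b + pi ^ lev i * e - (b + pi ^ lev i * e'))
    = val_ge j (e - e').
  rewrite opprD addrACA subrr add0r -mulrBr.
  by rewrite -{1}(val_expz_pi HF (lev i)) (val_ge_scale HF).
rewrite (@sum_hit_once _ _ _ _ HF k (fun e => map_at i (b + pi ^ lev i * e)) a
           (fun h : bool => g (h%:R - th))) //=.
- have qk : q ^+ k != 0 by rewrite expf_neq0 // gt_eqF // (qres_gt0 HF).
  by field.
- by move=> e _; apply: (intpart_ge0 HF).
move=> e e' ek ek' h.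
have e0 := residues_ge0 HF ek; have e0' := residues_ge0 HF ek'.
have [x0 vx] : (b + pi ^ lev i * e' != 0) /\ (v (b + pi ^ lev i * e') = - m).
  apply: (@val_in_disc i b) => //; rewrite addrAC subrr add0r -[X in val_ge X]addr0.
  by rewrite -{1}(val_expz_pi HF (lev i)) (val_ge_scale HF).
apply: (residues_inj HF ek ek'); rewrite -close -map_at_isometry //.
by rewrite -[X in val_ge X]addr0 close; apply: (val_geB HF).
Qed.

(** Fourth-moment Markov inequality on any disc of level [lev i] centred on the sphere [v x = - m].
    In the induction [t] accumulates the excesses already decided, and uniformity of the bound in
    [b] plays the role of independence. *)
Lemma excess_tail i N t (c : rat) b : 0 < c -> b != 0 -> v b = - m ->
  disc_bounded (fun x => c <= `|t + \sum_(j < N) exc (i + j)%N x|) b (lev i)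
    (moment4 th N t / c ^+ 4).
Proof.
move=> c0; elim: N i t b => [|N IH] i t b b0 vb.
  have E : moment4 th 0 t = t ^+ 4 by rewrite /moment4 mulr0n; ring.
  (* With no variable left the event is constant on the disc: everything if [c] is at most the
     absolute value of [t], where [t^4 / c^4 >= 1], and empty otherwise. *)
  rewrite E; have [ct|tc] := leP c `|t|.
    exists [:: (b, lev i)]; split; first by move=> x xb _; exists (b, lev i); rewrite ?inE.
    rewrite big_seq1 /= ler_peMl ?(ltW (disc_measure_gt0 HF _)) //.
    rewrite ler_pdivlMr ?exprn_gt0 // mul1r.
    rewrite -[t ^+ 4]ger0_norm ?normrX; last by rewrite (exprM t 2 2) sqr_ge0.
    by rewrite lerXn2r // nnegrE ?normr_ge0 // ltW.
  exists [::]; split; first by move=> x _; rewrite big_ord0 addr0 leNgt tc.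
  rewrite big_nil mulr_ge0 ?(ltW (disc_measure_gt0 HF _)) // divr_ge0 //.
    by rewrite (exprM t 2 2) sqr_ge0.
  by rewrite exprn_ge0 // ltW.
(* The bound for the remaining N excesses is averaged over the [q^k] subdiscs on which [exc i] is
   constant. *)
rewrite moment4_step mulrDl -!mulrA.
rewrite -(@sum_subdiscs i b (fun y => moment4 th N (t + y) / c ^+ 4)) // -mulr_suml.
apply: (disc_bounded_split HF) => e ek; set b' := b + _.
have b'b : val_ge (lev i) (b' - b).
  rewrite /b' [b + _ - _]addrAC subrr add0r -[X in val_ge X]addr0.
  by rewrite -{1}(val_expz_pi HF (lev i)) (val_ge_scale HF) ?(expfz_pi_neq0 HF) // (residues_ge0 HF ek).
have [b'0 vb'] := val_in_disc b0 vb b'b.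
(* The gap between [lev i + k] and [lev i.+1] is crossed by a further subdivision with the same
   bound on every piece. *)
apply: (@disc_bounded_split_const _ _ _ (absz m * M - k)%N) => f fk.
set b'' := b' + _.
have b''b : inD v b' (lev i + k%:Z) b''.
  rewrite inDE /b'' [b' + _ - _]addrAC subrr add0r -[X in val_ge X]addr0.
  by rewrite -{1}(val_expz_pi HF (lev i + k%:Z)) (val_ge_scale HF) ?(expfz_pi_neq0 HF) //
    (residues_ge0 HF fk).
have [b''0 vb''] : (b'' != 0) /\ (v b'' = - m).
  apply: (@val_in_disc i b') => //; rewrite inDE in b''b; apply: val_ge_le b''b; lia.
rewrite -addrA -PoszD -levS.
apply: disc_bounded_sub (IH i.+1 (t + exc i b') b'' b''0 vb'').
move=> x xb; rewrite big_ord_recl addn0 addrA => h.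
have xb' : inD v b' (lev i + k%:Z) x.
  rewrite !inDE in xb b''b *; rewrite -(subrKA b''); apply: (val_geD HF) => //.
  by rewrite levS in xb; apply: val_ge_le xb; lia.
rewrite (hit_subdisc b'0 vb' xb') in h; apply: le_trans h _.
rewrite le_eqVlt; apply/orP; left; apply/eqP; congr (`| _ + _ |).
by apply: eq_bigr => j _; rewrite addSnnS.
Qed.

End Tree.

(** * Null sets *)

Lemma choice_nat (T : Type) (t0 : T) (P : nat -> T -> Prop) :
  (forall n, exists t, P n t) -> exists f : nat -> T, forall n, P n (f n).
Proof.
move=> H; exists (fun n => epsilon (inhabits t0) (P n)) => n.
exact: epsilon_spec (H n).
Qed.

Lemma sum_halves_le (dl : rat) N : 0 <= dl -> \sum_(i < N) dl / 2 ^+ i.+1 <= dl.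
Proof.
move=> dl0; suff -> : \sum_(i < N) dl / 2 ^+ i.+1 = dl - dl / 2 ^+ N.
  by rewrite lerBlDr lerDl divr_ge0 ?exprn_ge0.
elim: N => [|N IH]; first by rewrite big_ord0 expr0 divr1 subrr.
by rewrite big_ord_recr /= IH exprS; field; rewrite expf_neq0.
Qed.

Lemma ler_sum_subset (T : eqType) (s s' : seq T) (w : T -> rat) :
  (forall t, 0 <= w t) -> uniq s -> {subset s <= s'} ->
  \sum_(t <- s) w t <= \sum_(t <- s') w t.
Proof.
move=> w0; elim: s s' => [|x s IH] s' /=.
  by move=> _ _; rewrite big_nil; apply: sumr_ge0.
case/andP=> xs us sub; have xs' : x \in s' by apply: sub; exact: mem_head.
rewrite (perm_big _ (perm_to_rem xs')) !big_cons lerD2l; apply: IH => // y ys.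
have : y \in s' by apply: sub; rewrite inE ys orbT.
rewrite (perm_mem (perm_to_rem xs')) inE => /orP[/eqP yx|//].
by rewrite -yx ys in xs.
Qed.

Lemma sum_pmap (T : Type) (f : nat -> option T) (w : T -> rat) (s : seq nat) :
  \sum_(n <- s) oapp w 0 (f n) = \sum_(t <- pmap f s) w t.
Proof.
elim: s => [|n s IH] /=; first by rewrite !big_nil.
by rewrite big_cons IH; case: (f n) => [t|] /=; rewrite ?big_cons ?add0r.
Qed.

(** The finitely many pairs with code below N lie in a square of side K, and [w] is nonnegative. *)
Lemma sum_pickle_inv_le (w : nat * nat -> rat) N : (forall p, 0 <= w p) ->
  exists K, \sum_(n < N) oapp w 0 (pickle_inv n) <= \sum_(i < K) \sum_(j < K) w (i : nat, j : nat).
Proof.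
move=> w0; pose s : seq (nat * nat) := pmap pickle_inv (iota 0 N).
have us : uniq s by apply: (pmap_uniq (@pickle_invK _)); exact: iota_uniq.
pose K := (\max_(p <- s) maxn p.1 p.2).+1.
exists K; rewrite -(big_mkord xpredT (fun n => oapp w 0 (pickle_inv n))) /index_iota subn0.
rewrite sum_pmap; apply: (@le_trans _ _ (\sum_(p <- [seq (i, j) | i <- iota 0 K, j <- iota 0 K]) w p)).
  apply: ler_sum_subset => // -[i j] ps; apply/allpairsP; exists (i, j).
  rewrite !mem_iota /= !add0n !ltnS.
  have : (maxn i j <= \max_(p <- s) maxn p.1 p.2)%N.
    exact: (@leq_bigmax_seq _ _ xpredT (fun p : nat * nat => maxn p.1 p.2) (i, j)).
  by rewrite geq_max => /andP[-> ->].
rewrite big_allpairs le_eqVlt; apply/orP; left; apply/eqP.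
rewrite -(big_mkord xpredT (fun i => \sum_(j < K) w (i, j : nat))) /index_iota subn0.
by apply: eq_bigr => i _; rewrite -(big_mkord xpredT (fun j => w (i, j))) /index_iota subn0.
Qed.

Section Covers.
Variables (F : fieldType) (v : F -> int) (pi : F) (C : seq F).
Hypothesis HF : is_local_field v pi C.
Local Notation mu := (disc_measure C).

Definition odisc_measure (d : option (F * int)) : rat := oapp (fun d => mu d.2) 0 d.

Lemma odisc_measure_ge0 d : 0 <= odisc_measure d.
Proof. by case: d => //= d; rewrite ltW // (disc_measure_gt0 HF). Qed.

Definition in_odisc (d : option (F * int)) (x : F) : bool :=
  if d is Some (a, k) then inD v a k x else false.

Definition covered (S : F -> Prop) (dl : rat) : Prop :=
  exists d : nat -> option (F * int),
    (forall x, S x -> exists i, in_odisc (d i) x) /\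
    (forall N, \sum_(i < N) odisc_measure (d i) <= dl).

Definition null (S : F -> Prop) : Prop := forall dl, 0 < dl -> covered S dl.

Lemma covered_le (S : F -> Prop) dl dl' : dl <= dl' -> covered S dl -> covered S dl'.
Proof. by move=> dd [d [Hd sd]]; exists d; split=> // N; apply: le_trans (sd N) dd. Qed.

Lemma covered_sub (S T : F -> Prop) dl : (forall x, S x -> T x) -> covered T dl -> covered S dl.
Proof. by move=> ST [d [Hd sd]]; exists d; split=> // x /ST; exact: Hd. Qed.

Lemma null_sub (S T : F -> Prop) : (forall x, S x -> T x) -> null T -> null S.
Proof. by move=> ST nT dl /nT; apply: covered_sub. Qed.

Lemma disc_bounded_covered S b l c : disc_bounded v C S b l c ->
  covered (fun x => inD v b l x /\ S x) (c * mu l).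
Proof.
move=> [s [Hs sc]]; exists (fun i => nth None (map some s) i); split.
  move=> x [xb Sx]; have [d ds xd] := Hs x xb Sx; exists (index d s).
  by rewrite (nth_map d) ?index_mem // nth_index //; case: d ds xd.
move=> N; apply: le_trans sc; elim: s {Hs} N => [|d s IH] N.
  by rewrite big_nil big1 // => i _; rewrite nth_nil.
case: N => [|N].
  by rewrite big_ord0; apply: sumr_ge0 => e _; rewrite ltW // (disc_measure_gt0 HF).
by rewrite big_ord_recl big_cons lerD2l; exact: IH.
Qed.

(** Countable subadditivity: [pickle] enumerates the double family of discs, and each partial sum is
    dominated by one over a square. *)
Lemma covered_bigcup (S : nat -> F -> Prop) (dl : nat -> rat) D :
  (forall i, covered (S i) (dl i)) -> (forall N, \sum_(i < N) dl i <= D) ->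
  covered (fun x => exists i, S i x) D.
Proof.
move=> /(choice_nat (fun=> None))[d Hd] sD.
pose e (p : nat * nat) := d p.1 p.2.
exists (fun n => oapp e None (pickle_inv n)); split.
  move=> x [i Sx]; have [j xj] := (Hd i).1 x Sx.
  by exists (pickle (i, j)); rewrite pickleK_inv.
move=> N; have [p|K sK] := @sum_pickle_inv_le (fun p => odisc_measure (e p)) N.
  exact: odisc_measure_ge0.
apply: le_trans (sD K); apply: le_trans (le_trans sK _); last first.
  by apply: ler_sum => i _; exact: (Hd i).2.
by apply: ler_sum => n _; case: (pickle_inv n).
Qed.

Lemma null_bigcup (S : nat -> F -> Prop) :
  (forall i, null (S i)) -> null (fun x => exists i, S i x).
Proof.
move=> nS dl dl0; apply: (@covered_bigcup _ (fun i => dl / 2 ^+ i.+1)).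
  by move=> i; apply: nS; rewrite divr_gt0 // exprn_gt0.
by move=> N; apply: sum_halves_le; exact: ltW.
Qed.

Lemma null_bigcup_seq (T : eqType) (s : seq T) (S : T -> F -> Prop) :
  (forall t, t \in s -> null (S t)) -> null (fun x => exists2 t, t \in s & S t x).
Proof.
move=> nS; case: s nS => [|t0 s] nS.
  move=> dl dl0; exists (fun=> None); split; first by move=> x [].
  by move=> N; rewrite big1 ?ltW.
apply: (@null_sub _ (fun x => exists i, (i < size (t0 :: s))%N /\ S (nth t0 (t0 :: s) i) x)).
  by move=> x [t ts St]; exists (index t (t0 :: s)); rewrite index_mem nth_index.
apply: null_bigcup => i; have [lt|ge] := ltnP i (size (t0 :: s)).
  by apply: null_sub (nS _ (mem_nth t0 lt)) => x [].
move=> dl dl0; exists (fun=> None); split; first by move=> x [].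
by move=> N; rewrite big1 ?ltW.
Qed.

Lemma null_set0 (S : F -> Prop) : (forall x, ~ S x) -> null S.
Proof.
move=> nS dl dl0; exists (fun=> None); split; first by move=> x /nS.
by move=> N; rewrite big1 ?ltW.
Qed.

(* [haar_null] asks for genuine discs: the unused slots of a cover are filled
   with discs of total measure at most half of the allowance. *)
Lemma null_haar_null S : null S -> haar_null v C S.
Proof.
move=> nS m; pose dl : rat := (m.+1%:Q)^-1 / 2.
have m0 : 0 < m.+1%:Q :> rat by [].
have dl0 : 0 < dl by rewrite divr_gt0 // invr_gt0.
have [d [Hd sd]] := nS dl dl0.
(* Chosen so that [2^K >= 4 (m + 1)]; hence [q^-(K + i)] is at most [dl / 2^(i + 1)]. *)
pose K := (4 * m.+1)%N.
pose e i := odflt (0, (K + i)%N%:Z) (d i).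
exists (fun i => (e i).1), (fun i => (e i).2); split.
  by move=> x /Hd[i xi]; exists i; move: xi; rewrite /e; case: (d i) => [[]|].
move=> N.
have q2 : 2 <= (qres C)%:Q by rewrite (ler_nat _ 2); exact: (qres_gt1 HF).
have pad i : mu (K + i)%N%:Z <= dl / 2 ^+ i.+1.
  have qX n : 2 ^+ n <= (qres C)%:Q ^+ n by rewrite lerXn2r // nnegrE; lra.
  have X0 n : 0 < 2 ^+ n :> rat by rewrite exprn_gt0.
  rewrite /disc_measure -exprnN; apply: (@le_trans _ _ (2 ^+ (K + i))^-1).
    by rewrite lef_pV2 ?posrE ?exprn_gt0 ?(qres_gt0 HF).
  have mK : 4 * m.+1%:R <= 2 ^+ K :> rat.
    by rewrite -natrM -natrX ler_nat ltnW // ltn_expl.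
  rewrite exprD invfM exprS invfM /dl; rewrite !mulrA ler_pM2r ?invr_gt0 //.
  rewrite -!mulrA -invfM -invfM lef_pV2 ?posrE ?mulr_gt0 //.
  by apply: le_trans mK; rewrite -[m.+1%:Q]/(m.+1%:R); lra.
have -> : (m.+1%:Q)^-1 = dl + dl by rewrite /dl -splitr.
apply: le_trans (lerD (sd N) (sum_halves_le N (ltW dl0))); rewrite -big_split; apply: ler_sum => i _.
rewrite /e; case: (d i) => [D|] /=; last by rewrite add0r pad.
by rewrite lerDl divr_ge0 ?exprn_ge0 // ltW.
Qed.
End Covers.

(** * Cesaro averages *)

Definition small_avg (g : nat -> rat) : Prop :=
  forall eps : rat, 0 < eps -> exists N0 : nat, forall N, (N0 <= N)%N ->
    `|\sum_(i < N) g i| <= eps * N%:R.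

Lemma eventually_le_natM (c eps : rat) : 0 < eps ->
  exists N0 : nat, forall N, (N0 <= N)%N -> c <= eps * N%:R.
Proof.
move=> e0; exists (Num.bound `|c / eps|) => N NN.
rewrite mulrC -ler_pdivrMr //; apply: le_trans (ler_norm _) _.
apply: le_trans (ltW (archi_boundP (normr_ge0 _))) _.
by rewrite ler_nat.
Qed.

Lemma norm_sum_le (g : nat -> rat) (N : nat) : (forall i, `|g i| <= 1) ->
  `|\sum_(i < N) g i| <= N%:R.
Proof.
move=> g1; apply: (le_trans (ler_norm_sum _ _ _)).
apply: (@le_trans _ _ (\sum_(i < N) 1)); first by apply: ler_sum => i _; exact: g1.
by rewrite sumr_const card_ord.
Qed.

Lemma sum_shift (g : nat -> rat) m N :
  \sum_(i < m + N) g i = \sum_(i < m) g i + \sum_(i < N) g (m + i)%N.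
Proof. by rewrite big_split_ord. Qed.

Lemma small_avg_shift (g : nat -> rat) m : (forall i, `|g i| <= 1) ->
  small_avg (fun i => g (m + i)%N) -> small_avg g.
Proof.
move=> g1 sg eps e0; have e2 : 0 < eps / 2 by lra.
have [N0 H0] := sg _ e2; have [N1 H1] := eventually_le_natM m%:R e2.
exists (maxn N1 (m + N0)) => N; rewrite geq_max => /andP[N1N mN].
have mN' : (m <= N)%N by lia.
have := sum_shift g m (N - m); rewrite subnKC // => ->; have h1 := H1 N N1N.
have /H0 h2 : (N0 <= N - m)%N by lia.
have h3 : eps / 2 * (N - m)%:R <= eps / 2 * N%:R by rewrite ler_pM2l // ler_nat leq_subr.
apply: le_trans (ler_normD _ _) _.
by have := norm_sum_le m g1; lra.
Qed.

Lemma sum_by_classes (g : nat -> rat) M Q :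
  \sum_(j < Q * M) g j = \sum_(r < M) \sum_(i < Q) g (r + M * i)%N.
Proof.
elim: Q => [|Q IH]; first by rewrite big_ord0 big1 // => r _; rewrite big_ord0.
rewrite mulSn addnC sum_shift IH -big_split /=; apply: eq_bigr => r _.
by rewrite big_ord_recr /= addnC mulnC.
Qed.

Lemma finite_threshold (P : nat -> nat -> Prop) M :
  (forall r, (r < M)%N -> exists N0, forall N, (N0 <= N)%N -> P r N) ->
  exists N0, forall r N, (r < M)%N -> (N0 <= N)%N -> P r N.
Proof.
elim: M => [|M IH] H; first by exists 0%N.
have [r rM|N0 H0] := IH; first by apply: H; apply: ltnW.
have [N1 H1] := H M (ltnSn M).
exists (maxn N0 N1) => r N; rewrite ltnS leq_eqVlt geq_max => /orP[/eqP->|rM] /andP[h0 h1].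
  exact: H1.
exact: H0.
Qed.

(** Three contributions of at most [eps / 4 * N] each: the incomplete last block, the main estimate
    over the classes, and the trivial bound on the bad classes. *)
Lemma small_avg_classes (g : nat -> rat) : (forall i, `|g i| <= 1) ->
  (forall eps : rat, 0 < eps -> exists (M : nat) (bad : pred nat),
     [/\ (0 < M)%N, (count bad (iota 0 M))%:R <= eps * M%:R &
      forall r, (r < M)%N -> ~~ bad r -> small_avg (fun i => g (r + M * i)%N)]) ->
  small_avg g.
Proof.
move=> g1 H eps e0; have e4 : 0 < eps / 4 by lra.
have [M [bad [M0 badM good]]] := H _ e4.
have [|Q0 HQ] := @finite_threshold (fun r Q => ~~ bad r ->
   `|\sum_(i < Q) g (r + M * i)%N| <= eps / 4 * Q%:R) M.
  move=> r rM; have [b|b] := boolP (bad r); first by exists 0%N.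
  by have [Q0 HQ] := good r rM b _ e4; exists Q0 => N QN _; exact: HQ.
have [N1 H1] := eventually_le_natM M%:R e4.
exists (maxn N1 (Q0 * M)) => N; rewrite geq_max => /andP[N1N QN].
have h1 := H1 N N1N; set Q := (N %/ M)%N.
have QQ : (Q0 <= Q)%N by rewrite leq_divRL.
have NE : N = (Q * M + N %% M)%N by exact: divn_eq.
have := sum_shift g (Q * M) (N %% M); rewrite -NE sum_by_classes => ->.
apply: le_trans (ler_normD _ _) _.
have hm : `|\sum_(i < N %% M) g (Q * M + i)%N| <= M%:R.
  apply: le_trans (norm_sum_le _ (fun i => g1 (Q * M + i)%N)) _.
  by rewrite ler_nat ltnW // ltn_mod.
have hs : `|\sum_(r < M) \sum_(i < Q) g (r + M * i)%N| <=
    \sum_(r < M) (eps / 4 * Q%:R + (bad r)%:R * Q%:R).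
  apply: (le_trans (ler_norm_sum _ _ _)); apply: ler_sum => r _.
  have [b|b] := boolP (bad r).
    rewrite mul1r; apply: le_trans (norm_sum_le _ (fun i => g1 (r + M * i)%N)) _.
    by rewrite lerDr mulr_ge0 // ltW.
  by rewrite mul0r addr0; exact: HQ.
have cE : \sum_(r < M) (bad r)%:R = (count bad (iota 0 M))%:R :> rat.
  rewrite -sum1_count natr_sum [RHS]big_mkcond -(big_mkord xpredT (fun r => (bad r)%:R)).
  by rewrite /index_iota subn0; apply: eq_bigr => r _; case: (bad r).
rewrite big_split /= -!mulr_suml cE sumr_const card_ord -[_ *+ M]mulr_natr in hs.
have Q0' : 0 <= Q%:R :> rat by [].
have h2 := ler_wpM2r Q0' badM.
have h3 : M%:R * Q%:R <= N%:R :> rat by rewrite -natrM ler_nat NE mulnC leq_addr.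
have h4 := ler_wpM2l (ltW e4) h3.
have h5 : 0 <= eps * N%:R by rewrite mulr_ge0 // ltW.
lra.
Qed.

(** Telescoping, from [1 / (x + 1)^2 <= 1 / x - 1 / (x + 1)]. *)
Lemma sum_inv_sqr_le N1 R : (0 < N1)%N ->
  \sum_(n < R) ((N1 + n).+1%:R ^+ 2)^-1 <= N1%:R^-1 :> rat.
Proof.
move=> N1_gt0.
suff : \sum_(n < R) ((N1 + n).+1%:R ^+ 2)^-1 <= N1%:R^-1 - (N1 + R)%:R^-1 :> rat.
  by move/le_trans; apply; rewrite gerBl invr_ge0.
elim: R => [|R IH]; first by rewrite big_ord0 addn0 subrr.
rewrite big_ord_recr /= addnS -natr1.
have : 0 < (N1 + R)%:R :> rat by rewrite ltr0n addn_gt0 N1_gt0.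
move: ((N1 + R)%:R) IH => x IH x0.
have h : ((x + 1) ^+ 2)^-1 <= x^-1 - (x + 1)^-1.
  have -> : x^-1 - (x + 1)^-1 = (x * (x + 1))^-1 by field; rewrite !gt_eqF //; lra.
  rewrite lef_pV2 ?posrE; nra.
lra.
Qed.

(** * The strong law along one progression *)

Section ProgressionNull.
Variables (F : fieldType) (v : F -> int) (pi : F) (C : seq F).
Hypothesis HF : is_local_field v pi C.
Local Notation val_ge := (val_ge v).
Local Notation q := ((qres C)%:Q).
Local Notation excess := (excess v pi C).
Local Notation null := (null v C).

Lemma theta_ge0 k : 0 <= (q ^+ k)^-1.
Proof. by rewrite invr_ge0 exprn_ge0. Qed.

Lemma theta_le1 k : (q ^+ k)^-1 <= 1.
Proof.
rewrite invf_le1 ?exprn_gt0 ?(qres_gt0 HF) // exprn_ege1 //.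
by rewrite (ler_nat _ 1) (ltnW (qres_gt1 HF)).
Qed.

Lemma excess_le1 alpha a k n x : `|excess alpha a k n x| <= 1.
Proof.
have := theta_ge0 k; have := theta_le1 k; rewrite /excess.
by case: (hit _ _ _ _ _ _ _ _); rewrite ler_norml /=; lra.
Qed.

Variables (alpha a : F) (k : nat) (m : int) (n0 M : nat) (w : int).
Hypotheses (alpha0 : alpha != 0) (a0 : val_ge 0 a) (m1 : 1 <= m) (kM : (k <= M)%N).
Hypothesis nval : forall i, ((n0 + M * i).+1%:R != 0 :> F) /\ v (n0 + M * i).+1%:R = w.
Hypothesis n0_large : 0 < fine_level v alpha m n0 w + m - w.
Local Notation exc i := (excess alpha a k (n0 + M * i).+1).
Local Notation lev := (fine_level v alpha m n0 w).

(** Borel-Cantelli: a deviation of [N / (j + 1)] has relative measure at most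
    [4 N^2 (j + 1)^4 / N^4], which is summable in N. *)
Lemma excess_disc_null (b : F) (j : nat) : b != 0 -> v b = - m ->
  null (fun x => inD v b lev x /\ forall N0, exists2 N, (N0 <= N)%N &
     N%:R / j.+1%:R <= `|\sum_(i < N) exc i x|).
Proof.
move=> b0 vb dl dl0.
have mu0 := disc_measure_gt0 HF lev.
pose K : rat := j.+1%:R ^+ 4 *+ 4 * disc_measure C lev.
have K0 : 0 <= K by rewrite mulr_ge0 ?mulrn_wge0 ?exprn_ge0 // ltW.
have [N1 HN1] := eventually_le_natM K dl0.
(* Starting at [N1 + 2] makes the tail sum at most [K / (N1 + 1)], hence at most [dl]. *)
pose N n := (N1.+1 + n).+1.
apply: (@covered_sub _ _ _ _ (fun x => exists n, inD v b lev x /\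
    (N n)%:R / j.+1%:R <= `|0 + \sum_(i < N n) exc (0 + i)%N x|)).
  move=> x [xb Hx]; have [R NR h] := Hx N1.+2; exists (R - N1.+2)%N; split=> //.
  have -> : N (R - N1.+2)%N = R by rewrite /N; lia.
  by rewrite add0r.
apply: (covered_bigcup HF (dl := fun n => K / (N n)%:R ^+ 2)).
  move=> n; have c0 : 0 < (N n)%:R / j.+1%:R :> rat by rewrite divr_gt0.
  have := excess_tail HF alpha0 a0 m1 kM nval n0_large 0 (N n) 0 c0 b0 vb.
  rewrite muln0 addn0 => /(disc_bounded_covered HF); apply: covered_le.
  rewrite /K [leRHS]mulrAC ler_pM2r //.
  have n0' : (N n)%:R != 0 :> rat by rewrite pnatr_eq0.
  have j0 : j.+1%:R != 0 :> rat by rewrite pnatr_eq0.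
  apply: (@le_trans _ _ ((N n)%:R ^+ 2 *+ 4 / ((N n)%:R / j.+1%:R) ^+ 4)).
    rewrite ler_pM2r ?invr_gt0 ?exprn_gt0 //.
    exact: moment4_le (theta_ge0 k) (theta_le1 k).
  rewrite le_eqVlt; apply/orP; left; apply/eqP; field.
  by rewrite n0' nat1r j0.
move=> R; rewrite -mulr_sumr.
apply: (le_trans (ler_wpM2l K0 (sum_inv_sqr_le R (ltn0Sn N1)))).
by rewrite ler_pdivrMr //; apply: HN1.
Qed.

(** If the averages do not tend to 0, some bound [1 / (j + 1)] is reached for arbitrarily large N.
    The union runs over [j] and over finitely many discs of level [lev] covering the sphere. *)
Lemma excess_progression_null :
  null (fun x => x != 0 /\ v x = - m /\ ~ small_avg (fun i => exc i x)).
Proof.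
have lm : - m < lev.
  by have := lev_gt HF alpha0 a0 m1 kM nval n0_large 0; rewrite muln0 addn0.
pose J := absz (lev + m).
have JE : - m + J%:Z = lev by rewrite /J; lia.
pose B e := pi ^ (- m) * e.
pose bad j e x := (B e != 0 /\ v (B e) = - m) /\
    (inD v (B e) lev x /\ forall N0, exists2 N, (N0 <= N)%N &
     N%:R / j.+1%:R <= `|\sum_(i < N) exc i x|).
apply: (@null_sub _ _ _ _ (fun x => exists j, exists2 e, e \in residues pi C J & bad j e x)).
  move=> x [x0 [vx nsx]].
  have [j Hj] : exists j : nat, forall N0, exists2 N, (N0 <= N)%N &
     N%:R / j.+1%:R <= `|\sum_(i < N) exc i x|.
    apply: NNPP => H; apply: nsx => eps e0.
    have [j0 Hj] := eventually_le_natM 1 e0.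
    apply: NNPP => H2; apply: H; exists j0 => N0.
    apply: NNPP => H3; apply: H2; exists N0 => N NN.
    rewrite leNgt; apply/negP => h; apply: H3; exists N => //.
    apply: le_trans (ltW h).
    rewrite ler_pdivrMr // mulrAC ler_peMl //; exact: Hj.
  have xD : inD v 0 (- m) x by rewrite inDE subr0 -vx val_ge_val.
  have [e eJ] := subdisc_exists HF J xD; rewrite add0r JE => xe.
  exists j, e => //; split=> //; rewrite /B.
  have := val_in_disc HF alpha0 a0 m1 kM nval n0_large (i := 0) x0 vx (x := B e).
  rewrite muln0 addn0; by apply; rewrite -(val_geN HF) opprB -inDE.
apply: (null_bigcup HF (S := fun j x => exists2 e, e \in residues pi C J & bad j e x)) => j.
apply: (null_bigcup_seq HF) => e eJ.
(* Discs whose centre is off the sphere contribute nothing, since [bad] is false there. *)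
have [B0|B0] := eqVneq (B e) 0; first by apply: null_set0 => x [[/eqP]].
have [vB|vB] := eqVneq (v (B e)) (- m).
  by apply: null_sub (excess_disc_null j B0 vB) => x [].
by apply: null_set0 => x [[_ /eqP]]; rewrite (negPf vB).
Qed.
End ProgressionNull.

(** * Null exceptional sets *)

Section Criterion.
Variables (F : fieldType) (v : F -> int) (pi : F) (C : seq F).
Hypothesis HF : is_local_field v pi C.
Local Notation excess := (excess v pi C).
Local Notation null := (null v C).

Definition constant_val_progression (e M : nat) : Prop :=
  exists w, forall i, ((e + M * i)%:R != 0 :> F) /\ v (e + M * i)%:R = w.

Lemma excess_class_null (alpha a : F) (k : nat) (m : int) (g : nat -> nat) (e M : nat) :
  alpha != 0 -> val_ge v 0 a -> 1 <= m -> (k < M)%N ->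
  (forall i, g i = (e + M * i)%N) -> constant_val_progression e M ->
  null (fun x => x != 0 /\ v x = - m /\ ~ small_avg (fun i => excess alpha a k (g i) x)).
Proof.
move=> alpha0 a0 m1 kM gE [w Hw].
have e_gt0 : (0 < e)%N.
  by case: (Hw 0%N); rewrite muln0 addn0 lt0n => h _; apply: contraNneq h => ->.
(* Skipping [i0] terms makes the exponent exceed the absolute values of [v alpha] and [2 w]
   together, which gives the domination condition [large]. *)
pose i0 := (absz (v alpha) + absz w + absz w)%N.
pose n0 := (e.-1 + M * i0)%N.
have E i : (n0 + M * i).+1 = (e + M * (i0 + i))%N.
  by rewrite /n0 mulnDr addnA -[in RHS](prednK e_gt0).
have nval i : ((n0 + M * i).+1%:R != 0 :> F) /\ v (n0 + M * i).+1%:R = w.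
  by rewrite E; exact: Hw.
have large : 0 < fine_level v alpha m n0 w + m - w.
  have : (i0 <= n0)%N by rewrite /n0; nia.
  rewrite /fine_level /i0 => h.
  have : n0%:Z <= m * n0%:Z by rewrite ler_peMl.
  lia.
apply: null_sub (excess_progression_null HF alpha0 a0 m1 (ltnW kM) nval large).
move=> x [x0 [vx nsx]]; split=> //; split=> // sx; apply: nsx.
apply: (@small_avg_shift _ i0) => [i|]; first exact: (excess_le1 HF).
by move=> eps /sx[N0 HN]; exists N0 => N /HN; under eq_bigr do rewrite E -gE.
Qed.

(** Index classes modulo [M] carry exponents advancing by [M'], and the bad ones have proportion at
    most [1 / (t + 1)]. The classes are chosen from [t] alone, not from [x], so the exceptional sets
    form a countable family. *)
Lemma excess_null (alpha a : F) (k : nat) (m : int) (u : nat -> nat) :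
  alpha != 0 -> val_ge v 0 a -> 1 <= m ->
  (forall t : nat, exists (M M' : nat) (bad : pred nat),
     [/\ (0 < M)%N, (k < M')%N, (count bad (iota 0 M) * t.+1 <= M)%N &
      forall r, (r < M)%N -> ~~ bad r ->
        (forall i, u (r + M * i)%N = (u r + M' * i)%N) /\
        constant_val_progression (u r) M']) ->
  null (fun x => x != 0 /\ v x = - m /\ ~ small_avg (fun i => excess alpha a k (u i) x)).
Proof.
move=> alpha0 a0 m1 H.
pose good t (d : nat * nat * pred nat) :=
    [/\ (0 < d.1.1)%N, (k < d.1.2)%N, (count d.2 (iota 0 d.1.1) * t.+1 <= d.1.1)%N &
      forall r, (r < d.1.1)%N -> ~~ d.2 r ->
        (forall i, u (r + d.1.1 * i)%N = (u r + d.1.2 * i)%N) /\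
        constant_val_progression (u r) d.1.2].
have [|D HD] := @choice_nat _ (0%N, 0%N, xpred0) good.
  by move=> t; have [M [M' [bad h]]] := H t; exists (M, M', bad).
pose bad t r x := ~~ (D t).2 r /\ (x != 0 /\ v x = - m /\
   ~ small_avg (fun i => excess alpha a k (u (r + (D t).1.1 * i)%N) x)).
apply: (@null_sub _ _ _ _ (fun x => exists t, exists2 r, r \in iota 0 (D t).1.1 & bad t r x)).
  move=> x [x0 [vx nsx]]; apply: NNPP => nb; apply: nsx.
  apply: small_avg_classes => [i|eps e0]; first exact: (excess_le1 HF).
  have [t Ht] := eventually_le_natM 1 e0.
  have [M0 kM' cM goodr] := HD t; exists (D t).1.1, (D t).2; split=> //.
    have h1 := Ht t.+1 (leqnSn t).
    have h2 : (count (D t).2 (iota 0 (D t).1.1))%:R * t.+1%:R <= (D t).1.1%:R :> rat.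
      by rewrite -natrM ler_nat.
    have h3 := ler_wpM2l (ltW e0) h2.
    apply: le_trans h3; rewrite mulrCA ler_peMr //.
  move=> r rM br; apply: NNPP => nsx; apply: nb; exists t, r => //.
  by rewrite mem_iota.
apply: (null_bigcup HF (S := fun t x => exists2 r, r \in iota 0 (D t).1.1 & bad t r x)) => t.
apply: (null_bigcup_seq HF) => r; rewrite mem_iota /= add0n => rM.
have [br|br] := boolP ((D t).2 r).
  by apply: null_set0 => x [h _]; rewrite br in h.
have [M0 kM' cM goodr] := HD t; have [gE cw] := goodr r rM br.
by apply: null_sub (excess_class_null alpha0 a0 m1 kM' gE cw) => x [].
Qed.

(** The centre of a disc of level [k] may be moved to its residue modulo p^k, so countably many
    conditions control all discs. *)
Lemma unif_distr_of_excess (alpha x : F) (u : nat -> nat) :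
  (forall k a, a \in residues pi C k ->
     small_avg (fun i => excess alpha a k (u i.+1) x)) ->
  unif_distr v C (fun n => intpart v pi C (alpha * x ^+ u n)).
Proof.
move=> H a; rewrite inOE => a0 k eps e0.
have [b bk ab] := residues_exists HF k a0.
have e2 : 0 < eps / 2 by lra.
have [N0 HN0] := H k b bk _ e2; exists N0 => N NN N_gt0.
have N0' : 0 < N%:R :> rat by rewrite ltr0n.
have E : (count (fun n => inD v a k%:Z (intpart v pi C (alpha * x ^+ u n))) (iota 1 N))%:R
   - N%:R * ((qres C)%:Q ^+ k)^-1 = \sum_(i < N) excess alpha b k (u i.+1) x :> rat.
  rewrite /excess sumrB sumr_const card_ord mulr_natl; congr (_ - _).
  rewrite -sum1_count natr_sum big_mkcond /= (iotaDl 1 0) big_map.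
  rewrite -(big_mkord xpredT (fun i => (hit v pi C alpha b k (u i.+1) x)%:R)).
  rewrite /index_iota subn0; apply: eq_bigr => i _; rewrite /hit !inDE add1n.
  have ba : val_ge v k%:Z (b - a) by rewrite -(val_geN HF) opprB.
  rewrite -(subrKA b) (@val_geDl _ _ _ _ HF _ _ (b - a)) //.
  by case: (val_ge _ _ _).
have := HN0 N NN; rewrite -E; move: (count _ _) => c h.
rewrite -[c%:Q]/(c%:R) -[N%:Q]/(N%:R).
have -> : c%:R / N%:R - ((qres C)%:Q ^+ k)^-1 = (c%:R - N%:R * ((qres C)%:Q ^+ k)^-1) / N%:R.
  by rewrite mulrBl mulrAC divff ?mul1r // gt_eqF.
rewrite normrM normfV (gtr0_norm N0') ltr_pdivrMr //.
apply: le_lt_trans h _; rewrite ltr_pM2r //; lra.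
Qed.

(** The exceptional set is a countable union over the spheres [v x = - (m + 1)], the levels [k] and
    the residues modulo p^k. *)
Lemma power_haar_null (alpha : F) (u : nat -> nat) : alpha != 0 ->
  (forall k t : nat, exists (M M' : nat) (bad : pred nat),
     [/\ (0 < M)%N, (k < M')%N, (count bad (iota 0 M) * t.+1 <= M)%N &
      forall r, (r < M)%N -> ~~ bad r ->
        (forall i, u (r + M * i).+1 = (u r.+1 + M' * i)%N) /\
        constant_val_progression (u r.+1) M']) ->
  haar_null v C (fun x => abs_gt1 v x /\
    ~ unif_distr v C (fun n => intpart v pi C (alpha * x ^+ u n))).
Proof.
move=> alpha0 H; apply: (null_haar_null HF).
pose bad m k a x := x != 0 /\ v x = - (m.+1)%:Z /\
  ~ small_avg (fun i => excess alpha a k (u i.+1) x).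
apply: (@null_sub _ _ _ _ (fun x => exists m, exists k, exists2 a, a \in residues pi C k & bad m k a x)).
  move=> x [[x0 vx] nux]; exists (absz (v x)).-1; apply: NNPP => nb; apply: nux.
  apply: unif_distr_of_excess => k a ak; apply: NNPP => nsx; apply: nb.
  by exists k, a => //; split=> //; split=> //; lia.
apply: (null_bigcup HF (S := fun m x => exists k, exists2 a, a \in residues pi C k & bad m k a x)) => m.
apply: (null_bigcup HF (S := fun k x => exists2 a, a \in residues pi C k & bad m k a x)) => k.
apply: (null_bigcup_seq HF) => a ak.
by apply: (excess_null (u := fun i => u i.+1) alpha0 (residues_ge0 HF ak)) => // t; exact: H.
Qed.
End Criterion.

(** * Exponents with constant valuation *)

Lemma count_dvdn_succ d k : (0 < d)%N -> count (fun r => d %| r.+1)%N (iota 0 (d * k)) = k.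
Proof.
move=> d0; suff H n : count (fun r => d %| r.+1)%N (iota 0 n) = (n %/ d)%N.
  by rewrite H mulKn.
elim: n => [|n IH]; first by rewrite div0n.
by rewrite -addn1 iotaD count_cat IH /= add0n addn0 addn1 divnS // addnC.
Qed.

(** Writing [j = x (p - 1) + y], the candidate [j + x + 2 = x p + (y + 2)] is a multiple of [p]
    exactly when [y + 1 = p - 1], that is, when the quotient of [j + 1] jumps. *)
Lemma ndiv_enumS p j : (1 < p)%N -> ndiv_enum p j.+1 = (j + j %/ p.-1).+1.
Proof.
move=> p1; elim: j => [|j IH].
  by rewrite /= /next_ndiv dvdn1 div0n gtn_eqF.
rewrite [LHS]/= -[next_ndiv p (ndiv_enum p j)]/(ndiv_enum p j.+1) IH.
have p0 : (0 < p.-1)%N by lia.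
rewrite divnS //; set b := (p.-1 %| j.+1)%N.
have -> : next_ndiv p (j + j %/ p.-1).+1 = (if b then (j + j %/ p.-1).+3 else (j + j %/ p.-1).+2).
  rewrite /next_ndiv; suff -> : (p %| (j + j %/ p.-1).+2)%N = b by [].
  have E := divn_eq j p.-1; have lt := ltn_pmod j p0.
  move: E lt; set x := (j %/ p.-1)%N; set y := (j %% p.-1)%N => E lt.
  have -> : (j + x).+2 = (x * p + y.+2)%N by rewrite {1}E -{2}(prednK (ltnW p1)); nia.
  have -> : b = (p.-1 %| y.+1)%N by rewrite /b {1}E -addnS dvdn_addr // dvdn_mull.
  rewrite dvdn_addr ?dvdn_mull //.
  apply/idP/idP => /dvdn_leq h; last first.
    have -> : y.+2 = p by have := h isT; lia.
    by [].
  have -> : y.+1 = p.-1 by have := h isT; lia.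
  by [].
by case: b; lia.
Qed.

Lemma ndiv_enum_ndvd p j : (1 < p)%N -> ~~ (p %| ndiv_enum p j.+1)%N.
Proof.
move=> p1 /=; rewrite /next_ndiv; case: ifP => [h|->] //.
by rewrite -addn1 dvdn_addr // dvdn1 gtn_eqF.
Qed.

Section Arithmetic.
Variables (F : fieldType) (v : F -> int) (pi : F) (C : seq F).
Hypothesis HF : is_local_field v pi C.
Local Notation val_ge := (val_ge v).

(** Pigeonhole: two of the integers from 0 to q share a representative in [C]. *)
Lemma nat_in_ideal : exists2 d : nat, (0 < d)%N & val_ge 1 d%:R.
Proof.
pose rep (n : nat) := nth 0 C (find (fun c => val_ge 1 (n%:R - c)) C).
have repP n : (rep n \in C) /\ val_ge 1 (n%:R - rep n).
  have [c cC nc] := digit_exists HF (val_ge_nat HF n).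
  have h : has (fun c => val_ge 1 (n%:R - c)) C by apply/hasP; exists c.
  by split; [rewrite mem_nth // -has_find | exact: (nth_find 0 h)].
have : ~~ uniq (map rep (iota 0 (size C).+1)).
  apply: contraTN (ltnSn (size C)) => us; rewrite -leqNgt.
  rewrite -{1}(size_iota 0 (size C).+1) -(size_map rep).
  by apply: uniq_leq_size us _ => _ /mapP[n _ ->]; case: (repP n).
move/(uniqPn 0) => [i [j [ij jC E]]]; rewrite size_map size_iota in jC.
have iC := ltn_trans ij jC.
rewrite !(nth_map 0%N) ?size_iota // !nth_iota // !add0n in E.
exists (j - i)%N; first by rewrite subn_gt0.
rewrite natrB ?(ltnW ij) //.
have -> : j%:R - i%:R = (j%:R - rep j) - (i%:R - rep i) by rewrite E; ring.
by apply: (val_geB HF); [case: (repP j) | case: (repP i)].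
Qed.

(* [d] is the residue characteristic. *)
Lemma residue_char_exists : exists d : nat, [/\ (1 < d)%N, val_ge 1 d%:R &
  forall n : nat, val_ge 1 n%:R -> (d %| n)%N].
Proof.
have H : exists d : nat, (0 < d)%N && val_ge 1 d%:R.
  by have [d d0 vd] := nat_in_ideal; exists d; rewrite d0.
case: (ex_minnP H) => d /andP[d0 vd] dmin; exists d; split=> //.
  rewrite ltn_neqAle d0 andbT; apply: contraTneq vd => <-.
  by rewrite val_geE ?oner_neq0 // (val1 HF).
move=> n vn; rewrite /dvdn; apply: contraT => nd.
(* The remainder of [n] also lies in the maximal ideal; if nonzero, it would contradict the
   minimality of [d]. *)
have : (d <= n %% d)%N.
  apply: dmin; rewrite lt0n nd /=.
  have -> : (n %% d)%:R = n%:R - (n %/ d)%:R * d%:R :> F.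
    by rewrite {2}(divn_eq n d) natrD natrM addrAC subrr add0r.
  apply: (val_geB HF) => //; rewrite -[1]add0r; apply: (val_geM HF) => //.
  exact: (val_ge_nat HF).
by rewrite leqNgt ltn_pmod.
Qed.

(** Multiples of [d^t] have valuation at least [t v(d)], whereas [r + 1], not divisible by [d^t],
    has smaller valuation and so governs every sum. *)
Lemma constant_val_char0 (d : nat) t k r :
  (forall n : nat, (0 < n)%N -> n%:R != 0 :> F) -> (1 < d)%N -> val_ge 1 d%:R ->
  (forall n : nat, val_ge 1 n%:R -> (d %| n)%N) -> ~~ (d ^ t %| r.+1)%N ->
  constant_val_progression v r.+1 (d ^ t * k).
Proof.
move=> F0 d1 vd dmin ndr.
have d0 : d%:R != 0 :> F by apply: F0; apply: ltnW.
(* Induction on [t] by removing one factor [d]; a number not divisible by [d] lies outside the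
   maximal ideal. *)
have vlt : forall t n, (0 < n)%N -> ~~ (d ^ t %| n)%N -> v n%:R < v d%:R *+ t.
  move=> {t r ndr} t; elim: t => [|t IH] n n0; first by rewrite expn0 dvd1n.
  move=> ndn; have vd1 : 1 <= v d%:R by rewrite -val_geE.
  have [/dvdnP[n' nE]|ndn'] := boolP (d %| n)%N; last first.
    have : ~~ val_ge 1 n%:R by apply: contra ndn' => /dmin.
    have vt : 0 <= v d%:R *+ t by apply: mulrn_wge0; lia.
    by rewrite (val_geE _ _ (F0 n n0)) mulrS; lia.
  have n'0 : (0 < n')%N by move: n0; rewrite nE muln_gt0 => /andP[].
  have : ~~ (d ^ t %| n')%N.
    by apply: contra ndn; rewrite nE expnS mulnC => h; rewrite dvdn_mul.
  move/(IH _ n'0); rewrite nE natrM (valM HF (F0 _ n'0) d0) mulrS; lia.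
exists (v r.+1%:R) => i; rewrite natrD; apply: (val_add_gt HF); first exact: F0.
apply: (@val_ge_le _ _ _ (v d%:R *+ t + 0)).
  by have := vlt t r.+1 isT ndr; lia.
rewrite -mulnA natrM natrX; apply: (val_geM HF); last exact: val_ge_nat HF _.
by apply: (val_geX HF); exact: val_ge_val.
Qed.

End Arithmetic.

Theorem theorem1p1 (F : fieldType) (v : F -> int) (pi : F) (C : seq F)
  (HF : is_local_field v pi C) (alpha : F) (Halpha : alpha != 0) :
  ([pchar F] =i pred0 ->
     haar_null v C (fun x => abs_gt1 v x /\
        ~ unif_distr v C (fun n => intpart v pi C (alpha * x ^+ n)))) /\
  (forall p : nat, p \in [pchar F] ->
     haar_null v C (fun x => abs_gt1 v x /\
        ~ unif_distr v C (fun j => intpart v pi C (alpha * x ^+ ndiv_enum p j)))).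
Proof.
split=> [char0|p charp].
  have F0 (n : nat) : (0 < n)%N -> n%:R != 0 :> F.
    by rewrite (pcharf0P _).1 // lt0n.
  have [d [d1 vd dmin]] := residue_char_exists HF.
  apply: (power_haar_null HF (u := id)) => // k t.
  have d0 : (0 < d ^ t.+1)%N by rewrite expn_gt0 ltnW.
  have dt : (t.+1 < d ^ t.+1)%N by exact: ltn_expl.
  (* Index [r] stands for exponent [r + 1]. The bad classes are the [k + 1] multiples of
     [d^(t + 1)], a proportion of [1 / d^(t + 1)], below [1 / (t + 1)]. *)
  exists (d ^ t.+1 * k.+1)%N, (d ^ t.+1 * k.+1)%N, (fun r => d ^ t.+1 %| r.+1)%N.
  split; first by rewrite muln_gt0 d0.
  - nia.
  - by rewrite count_dvdn_succ // mulnC leq_mul2r ltnW ?orbT.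
  by move=> r _ ndr; split=> [i|]; [rewrite addSn | exact: (constant_val_char0 HF k.+1 F0 d1 vd dmin ndr)].
have pp : prime p := pcharf_prime charp; have p1 := prime_gt1 pp.
apply: (power_haar_null HF (u := ndiv_enum p)) => // k t.
have p0 : (0 < p.-1)%N by lia.
(* Every [p - 1] consecutive indices advance the exponent by [p], hence two different periods; no
   class is bad. *)
exists (p.-1 * k.+1)%N, (p * k.+1)%N, xpred0; split.
- by rewrite muln_gt0 p0.
- nia.
- by rewrite count_pred0.
move=> r _ _; split=> [i|].
  rewrite !ndiv_enumS //.
  have -> : ((r + p.-1 * k.+1 * i) %/ p.-1)%N = (k.+1 * i + r %/ p.-1)%N.
    by rewrite addnC -mulnA mulnC divnMDl.
  by rewrite -[p in RHS](prednK (ltnW p1)); nia.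
have pE : p%:R = 0 :> F := pcharf0 charp.
(* As [p = 0] in F, all exponents of the class have the same image in F, nonzero because they are
   prime to [p]. *)
exists (v (ndiv_enum p r.+1)%:R) => i.
rewrite natrD -mulnA natrM pE mul0r addr0; split=> //.
by rewrite -(dvdn_pcharf charp) ndiv_enum_ndvd.
Qed.
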